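(* Let $\mathcal{L}$ be a $\mathcal{J}$-subspace lattice on a Banach space $X$ over the real or complex field $\mathbb{F}$, and let $\mathrm{Alg}\mathcal{L}$ be the associated $\mathcal{J}$-subspace lattice algebra. Let $\xi\in\mathbb{F}$ with $\xi\neq 1$. Let $\mathcal{G}$ be the set of all $\xi$-Lie higher derivations on $\mathrm{Alg}\mathcal{L}$ by acting on zero products, i.e. all families $\{L_n\}_{n=0}^{\infty}$ of linear mappings $L_n:\mathrm{Alg}\mathcal{L}\to\mathrm{Alg}\mathcal{L}$ with $L_0=\mathrm{id}$ such that $L_n([A,B]_{\xi})=\sum_{i+j=n}[L_i(A),L_j(B)]_{\xi}$ for every $n\ge0$ and all $A,B\in\mathrm{Alg}\mathcal{L}$ with $AB=0$. Let $\mathcal{H}$ be the set of all sequences of $\xi$-Lie derivations on $\mathrm{Alg}\mathcal{L}$ by acting on zero products with first component zero, i.e. all sequences $\{\delta_n\}_{n=0}^{\infty}$ of linear mappings $\delta_n:\mathrm{Alg}\mathcal{L}\to\mathrm{Alg}\mathcal{L}$ with $\delta_0=0$ such that $\delta_n([A,B]_{\xi})=[\delta_n(A),B]_{\xi}+[A,\delta_n(B)]_{\xi}$ for every $n\ge0$ and all $A,B\in\mathrm{Alg}\mathcal{L}$ with $AB=0$. Then there is a one-to-one correspondence (bijection) between $\mathcal{G}$ and $\mathcal{H}$.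
   Context: Subspaces in a lattice are closed. A family $\mathcal{L}$ of subspaces of a Banach space $X$ is a subspace lattice if it contains $\{0\}$ and $X$ and is closed under arbitrary closed linear spans $\bigvee$ and intersections $\bigwedge$. $\mathrm{Alg}\mathcal{L}$ is the algebra of all bounded linear operators on $X$ leaving every subspace in $\mathcal{L}$ invariant. For $K\in\mathcal{L}$ put $K_-=\bigvee\{L\in\mathcal{L}: K\nsubseteq L\}$, and let $\mathcal{J}(\mathcal{L})=\{K\in\mathcal{L}: K\ne\{0\}\text{ and }K_-\ne X\}$. $\mathcal{L}$ is a $\mathcal{J}$-subspace lattice if: (1) $\bigvee\{K: K\in\mathcal{J}(\mathcal{L})\}=X$; (2) $\bigwedge\{K_-: K\in\mathcal{J}(\mathcal{L})\}=\{0\}$; (3) $K\bigvee K_-=X$ for each $K\in\mathcal{J}(\mathcal{L})$; (4) $K\bigwedge K_-=\{0\}$ for each $K\in\mathcal{J}(\mathcal{L})$. Then $\mathrm{Alg}\mathcal{L}$ is called a $\mathcal{J}$-subspace lattice algebra. $[A,B]_{\xi}=AB-\xi BA$. *)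

(* Defs.v *)
From HB Require Import structures.
From mathcomp Require Import all_boot all_order all_algebra.
From mathcomp Require Import complex.
From mathcomp Require Import all_classical all_reals all_analysis.

Set Implicit Arguments.
Unset Strict Implicit.
Unset Printing Implicit Defensive.

Import Order.TTheory GRing.Theory Num.Theory.
Import numFieldNormedType.Exports.

Local Open Scope classical_set_scope.
Local Open Scope ring_scope.

Inductive real_or_complex (R : realType) : numFieldType -> Prop :=
| RealScalars : real_or_complex R R
| ComplexScalars : real_or_complex R R[i].

Section SubspaceLattice.
Variables (F : numFieldType) (X : normedModType F).

Definition is_subspace (M : set X) : Prop :=
  M 0 /\ forall (a : F) (u v : X), M u -> M v -> M (a *: u + v).

(* The union is not closed under sums: take its linear span, then close up.
   The span of the empty family is {0}. *)
Definition closed_span (S : set (set X)) : set X :=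
  closure (smallest is_subspace (\bigcup_(M in S) M)).

(* The meet of the empty family is the whole space, since
   \bigcap_(M in set0) M = setT. *)
Record subspace_lattice := SubspaceLattice {
  sublat : set (set X);
  sublat_subspace : forall M, sublat M -> is_subspace M;
  sublat_closed : forall M, sublat M -> closed M;
  sublat_bot : sublat [set 0];
  sublat_top : sublat setT;
  sublat_join : forall S : set (set X), S `<=` sublat -> sublat (closed_span S);
  sublat_meet : forall S : set (set X),
    S `<=` sublat -> sublat (\bigcap_(M in S) M) }.

Definition lower (L : subspace_lattice) (K : set X) : set X :=
  closed_span [set M | sublat L M /\ ~ (K `<=` M)].

Definition Jset (L : subspace_lattice) : set (set X) :=
  [set K | [/\ sublat L K, K <> [set 0] & lower L K <> setT]].

Record is_Jlattice (L : subspace_lattice) : Prop := IsJlattice {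
  Jlattice_join : closed_span (Jset L) = setT;
  Jlattice_meet : \bigcap_(K in Jset L) lower L K = [set 0];
  Jlattice_joinK : forall K, Jset L K -> closed_span [set K; lower L K] = setT;
  Jlattice_meetK : forall K, Jset L K -> K `&` lower L K = [set 0] }.

End SubspaceLattice.

Section Alg.
Variables (F : numFieldType) (X : normedModType F) (L : subspace_lattice X).

Definition is_bounded_linear (T : X -> X) : Prop :=
  linear T /\ exists r : F, forall x, `|T x| <= r * `|x|.

Definition is_alg : {pred X -> X} := fun T =>
  `[< is_bounded_linear T /\ forall M, sublat L M -> forall x, M x -> M (T x) >].

Lemma is_algP (T : X -> X) :
  reflect (is_bounded_linear T /\ forall M, sublat L M -> forall x, M x -> M (T x))
          (T \in is_alg).
Proof. exact: asboolP. Qed.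

Fact is_alg_submod_closed : submod_closed is_alg.
Proof.
split.
  apply/is_algP; split; last by move=> M /sublat_subspace[].
  split=> [a u v|]; first by rewrite /GRing.zero/= scaler0 addr0.
  by exists 0 => x; rewrite normr0 mul0r.
move=> a S T /is_algP[[Slin [r Sr]] SL] /is_algP[[Tlin [s Ts]] TL].
apply/is_algP; split; last first.
  by move=> M LM x Mx; apply: (sublat_subspace LM).2; [exact: SL|exact: TL].
have E x : (a *: S + T) x = a *: S x + T x by [].
split=> [b u v|].
  by rewrite !E Slin Tlin !scalerDr !scalerA [b * a]mulrC addrACA.
exists (`|a| * r + s) => x.
rewrite E (le_trans (ler_normD _ _))// mulrDl lerD//.
by rewrite normrZ -mulrA ler_wpM2l.
Qed.

HB.instance Definition _ :=
  GRing.isSubmodClosed.Build F (X -> X) is_alg is_alg_submod_closed.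

Record alg := Alg { algval :> X -> X; algvalP : algval \in is_alg }.

HB.instance Definition _ := [isSub for algval].
HB.instance Definition _ := [Choice of alg by <:].
HB.instance Definition _ := [SubChoice_isSubLmodule of alg by <:].

Fact is_alg_id : id \in is_alg.
Proof.
apply/is_algP; split=> //; split=> //.
by exists 1 => x; rewrite mul1r.
Qed.

Fact is_alg_comp (S T : alg) : algval S \o algval T \in is_alg.
Proof.
have /is_algP[[Slin [r Sr]] SL] := algvalP S.
have /is_algP[[Tlin [s Ts]] TL] := algvalP T.
apply/is_algP; split; last by move=> M LM x /(TL M LM)/(SL M LM).
split=> [a u v|/=]; first by rewrite /= Tlin Slin.
exists (`|r| * s) => x; rewrite (le_trans (Sr _))//.
have [->|Tx0] := eqVneq (T x) 0.
  rewrite normr0 mulr0 -mulrA mulr_ge0//.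
  exact: le_trans (normr_ge0 _) (Ts x).
rewrite -mulrA (@le_trans _ _ (`|r| * `|T x|))//; last by rewrite ler_wpM2l.
rewrite ler_wpM2r// real_ler_norm//.
have Tx_gt0 : 0 < `|T x| by rewrite normr_gt0.
by rewrite ger0_real// -(pmulr_lge0 _ Tx_gt0) (le_trans _ (Sr _)).
Qed.

Definition alg_id : alg := Alg is_alg_id.
Definition alg_comp (S T : alg) : alg := Alg (is_alg_comp S T).

Fact alg_compA : associative alg_comp.
Proof. by move=> S T U; apply: val_inj. Qed.

Fact alg_comp1l : left_id alg_id alg_comp.
Proof. by move=> S; apply: val_inj. Qed.

Fact alg_comp1r : right_id alg_id alg_comp.
Proof. by move=> S; apply: val_inj. Qed.

Fact alg_compDl : left_distributive alg_comp +%R.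
Proof. by move=> S T U; apply: val_inj. Qed.

Fact alg_compDr : right_distributive alg_comp +%R.
Proof.
move=> S T U; apply: val_inj; apply/funext => x.
have /is_algP[[Slin _] _] := algvalP S.
rewrite [LHS]/(S (T x + U x)) [RHS]/(S (T x) + S (U x)).
by have := Slin 1 (T x) (U x); rewrite !scale1r.
Qed.

(* Multiplication is composition, not pointwise; the ring may be trivial,
   as X = {0} is allowed. *)
HB.instance Definition _ := GRing.Zmodule_isPzRing.Build alg
  alg_compA alg_comp1l alg_comp1r alg_compDl alg_compDr.

Definition xi_comm (xi : F) (A B : alg) : alg := A * B - xi *: (B * A).

Definition xi_Lie_higher_derivations (xi : F) :
    set (nat -> {linear alg -> alg}) :=
  [set D | (forall A, D 0%N A = A) /\
    forall n (A B : alg), A * B = 0 ->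
      D n (xi_comm xi A B) = \sum_(i < n.+1) xi_comm xi (D i A) (D (n - i)%N B)].

Definition xi_Lie_derivation_sequences (xi : F) :
    set (nat -> {linear alg -> alg}) :=
  [set d | (forall A, d 0%N A = 0) /\
    forall n (A B : alg), A * B = 0 ->
      d n (xi_comm xi A B) = xi_comm xi (d n A) B + xi_comm xi A (d n B)].

End Alg.

(* Main.v *)
Require Import Defs.
From HB Require Import structures.
From mathcomp Require Import all_boot all_order all_algebra.
From mathcomp Require Import complex.
From mathcomp Require Import all_classical all_reals all_analysis.
From mathcomp Require Import ring lra.
From Stdlib Require Ncring Ncring_tac.

(** A xi-Lie higher derivation D corresponds to its logarithmic derivative d,
    defined by n D_n = d_1 D_(n-1) + ... + d_n D_0, that is t D'(t) = d(t) D(t)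
    for the generating series. Over a field of characteristic zero D and d
    determine each other, so the point is that D obeys the higher rule exactly
    when every d_n is a xi-Lie derivation at zero products.

    For maps satisfying their rules at all products this is a formal
    computation, with [A, B] = A B - xi B A. Here it is not: A B = 0 does not make the products
    D_i(A) D_j(B) vanish, so the rule for d_n cannot be applied to them. The remedy
    is a structure theorem ([xi_Lie_structure]): a xi-Lie derivation d at zero
    products satisfies, for all A and B,
    d [A, B] = [d A, B] + [A, d B] - Z [A, B], where Z = d 1 is central and
    Z [A, B] = 0 whenever A B = 0; moreover d is linear over the centre. Then D_n,
    a sum of compositions of such maps, is linear over the centre too, and in the
    formal computation the error terms Z D_m [A, B] = D_m (Z [A, B]) disappear
    ([log_derivative_step]).

    The structure theorem rests on rank-one operators. For K in J(L), the operator
    y |-> f y x lies in Alg L for every x in K and every bounded linear functional f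
    that vanishes on the lower neighbour of K. The Hahn-Banach theorem provides
    enough functionals f for these operators to span an ideal S that consists of
    combinations of idempotents and for which a S a = 0 forces a = 0. The bilinear map
    psi (A, B) = d [A, B] - [d A, B] - [A, d B] vanishes at zero products; since
    A e (1 - e) B = 0 for idempotent e, it is balanced over S:
    psi (A R, B) = psi (A, R B) for R in S. Evaluating psi (R, B) and psi (B, R) in
    this way and adding shows, as xi <> 1, that tau = d - Z is a Jordan derivation
    as soon as one factor lies in S. Bresar's argument for semiprime rings turns
    tau into a derivation ([jordan_derivation_is_derivation]). Finally, a central
    element acts on a rank-one operator as a scalar, which makes tau vanish on the
    centre. *)

Set Implicit Arguments.
Unset Strict Implicit.
Unset Printing Implicit Defensive.

Import Order.TTheory GRing.Theory Num.Theory.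
Import numFieldNormedType.Exports.

Local Open Scope classical_set_scope.
Local Open Scope ring_scope.

(** * Identities in noncommutative rings *)

Section NoncommutativeRing.
Variable A : pzRingType.

#[local] Instance pzRing_ops :
  @Ncring.Ring_ops A 0 1 +%R *%R (fun x y => x - y) -%R eq := {}.

#[local] Instance pzRing_Ring :
  @Ncring.Ring A 0 1 +%R *%R (fun x y => x - y) -%R eq pzRing_ops.
Proof.
split; try exact _; try by [move=> ? ? -> ? ? ->|move=> ? ? ->].
- exact: add0r.
- exact: addrC.
- exact: addrA.
- exact: mul1r.
- exact: mulr1.
- exact: mulrA.
- by move=> x y z; exact: mulrDl.
- by move=> x y z; exact: mulrDr.
- by [].
- exact: subrr.
Qed.

(* Decides identities of noncommutative rings; centrality hypotheses have to be
   supplied as explicit commutators. *)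
Ltac ncring := Ncring_tac.non_commutative_ring.

(** Identities are derived from hypotheses in this form: d is a combination of
    hypotheses written as differences, and the second premise is left to the
    ring solver. *)
Lemma eq_by_diff (d x y : A) : d = 0 -> x - y = d -> x = y.
Proof. by move=> -> /eqP; rewrite subr_eq0 => /eqP. Qed.

Definition central (a : A) := forall b, a * b = b * a.

(** C is meant to be the set of scalars, seen inside the ring: its elements will
    be central and the maps under study linear over them. *)
Inductive idempotent_span (C : A -> Prop) : A -> Prop :=
| IdempotentSpanD x y :
    idempotent_span C x -> idempotent_span C y -> idempotent_span C (x + y)
| IdempotentSpanZ c e : C c -> e * e = e -> idempotent_span C (c * e).

(** * Derivations from Jordan derivations near a semiprime ideal *)

Section SemiprimeIdeal.
Variable S : A -> Prop.
Hypothesis SD : forall a b, S a -> S b -> S (a + b).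
Hypothesis SMl : forall a b, S b -> S (a * b).
Hypothesis SMr : forall a b, S a -> S (a * b).
Hypothesis Ssemiprime : forall a, (forall x, S x -> a * x * a = 0) -> a = 0.
Hypothesis torsion2 : forall a : A, a + a = 0 -> a = 0.

Let SN a : S a -> S (- a).
Proof. by move=> Sa; rewrite -mulN1r; exact: SMl. Qed.

Lemma faithful_left (a : A) : (forall x, S x -> a * x = 0) -> a = 0.
Proof. by move=> h; apply: Ssemiprime => x Sx; rewrite h// mul0r. Qed.

Lemma faithful_right (a : A) : (forall x, S x -> x * a = 0) -> a = 0.
Proof. by move=> h; apply: Ssemiprime => x Sx; rewrite -mulrA h// mulr0. Qed.

Lemma central_of_comm a : (forall x, S x -> a * x = x * a) -> central a.
Proof.
move=> h b; apply/eqP; rewrite -subr_eq0; apply/eqP; apply: faithful_left => x Sx.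
by rewrite mulrBl -!mulrA h ?h ?mulrA ?subrr//; exact: SMl.
Qed.

Lemma central_nilpotent a : central a -> a * a = 0 -> a = 0.
Proof.
by move=> ca aa; apply: Ssemiprime => x _; rewrite ca -mulrA aa mulr0.
Qed.

(** With t = u x c, moving u and c past each other three times gives
    t y t = - t y t for every y. *)
Lemma semiprime_swap (u c : A) :
  (forall x, u * x * c + c * x * u = 0) -> forall x, u * x * c = 0.
Proof.
move=> h x; apply: Ssemiprime => y _; apply: torsion2.
apply: (eq_by_diff (d := u * x * (u * y * c + c * y * u) * x * c
   - (u * (x * u * y) * c + c * (x * u * y) * u) * x * c
   + (u * x * c + c * x * u) * y * u * x * c)); last by ncring.
by rewrite !h; ncring.
Qed.

(** Polarisation: a relation u x c = 0 that is quadratic in a parameter entering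
    both u and c yields the mixed relation u x d + v x c = 0, and the two mixed
    terms vanish separately because (u x d) y (u x d) = - u (x d y v x) c. *)
Lemma semiprime_polarize (u v c d : A) :
  (forall x, u * x * c = 0) -> (forall x, u * x * d + v * x * c = 0) ->
  forall x, u * x * d = 0.
Proof.
move=> uc h x; apply: Ssemiprime => y _.
apply: (eq_by_diff (d := u * x * d * y * (u * x * d + v * x * c)
   - u * (x * d * y * v * x) * c)); last by ncring.
by rewrite h uc; ncring.
Qed.

Section JordanDerivation.
Variable tau : A -> A.
Hypothesis tauD : forall a b, tau (a + b) = tau a + tau b.
Hypothesis tauJ : forall a b, S a ->
  tau (a * b + b * a) = tau a * b + a * tau b + (tau b * a + b * tau a).

Let tau0 : tau 0 = 0.
Proof. by apply: (addrI (tau 0)); rewrite -tauD !addr0. Qed.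
Let tauN a : tau (- a) = - tau a.
Proof. by apply: (addrI (tau a)); rewrite -tauD !subrr. Qed.
Let tauB a b : tau (a - b) = tau a - tau b.
Proof. by rewrite tauD tauN. Qed.

Lemma jordan_sq a : S a -> tau (a * a) = tau a * a + a * tau a.
Proof.
move=> Sa; apply/eqP; rewrite -subr_eq0; apply/eqP; apply: torsion2.
apply: (eq_by_diff (d := tau (a * a + a * a)
   - (tau a * a + a * tau a + (tau a * a + a * tau a)))).
  by rewrite tauJ// subrr.
by rewrite tauD; ncring.
Qed.

(** 2 a b a = a o (a o b) - (a a) o b for the Jordan product o. *)
Lemma jordan_triple a b : S a ->
  tau (a * b * a) = tau a * b * a + a * tau b * a + a * b * tau a.
Proof.
move=> Sa; apply/eqP; rewrite -subr_eq0; apply/eqP; apply: torsion2.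
have E : tau (a * b * a) + tau (a * b * a) =
    tau (a * (a * b + b * a) + (a * b + b * a) * a) - tau (a * a * b + b * (a * a)).
  by rewrite -tauD -tauB; congr tau; ncring.
apply: (eq_by_diff (d := tau (a * b * a) + tau (a * b * a) -
    (tau (a * (a * b + b * a) + (a * b + b * a) * a)
     - tau (a * a * b + b * (a * a))))).
  by rewrite E subrr.
by rewrite tauJ// tauJ// [in RHS]tauJ ?jordan_sq//; [ncring | exact: SMl].
Qed.

Lemma jordan_triple_sym a b c : S a -> S c ->
  tau (a * b * c + c * b * a) = tau a * b * c + a * tau b * c + a * b * tau c
     + (tau c * b * a + c * tau b * a + c * b * tau a).
Proof.
move=> Sa Sc.
have -> : a * b * c + c * b * a =
  (a + c) * b * (a + c) - a * b * a - c * b * c by ncring.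
by rewrite !tauB !jordan_triple ?tauD//; [ncring | exact: SD].
Qed.

Let defect a b := tau (a * b) - tau a * b - a * tau b.

Let defectC a b : S a -> defect b a = - defect a b.
Proof.
move=> Sa; rewrite /defect; apply: (eq_by_diff (d := tau (a * b + b * a) -
  (tau a * b + a * tau b + (tau b * a + b * tau a)))).
  by rewrite tauJ// subrr.
by rewrite tauD; ncring.
Qed.

Let defectDl a b c : defect (a + b) c = defect a c + defect b c.
Proof. by rewrite /defect mulrDl !tauD; ncring. Qed.
Let defectDr a b c : defect a (b + c) = defect a b + defect a c.
Proof. by rewrite /defect mulrDr !tauD; ncring. Qed.

(** Herstein's identity, obtained by evaluating tau on
    a b x b a + b a x a b in two ways: as the sum of the nested triples
    a (b x b) a and b (a x a) b, and as the symmetric triple product of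
    a b, x and b a. *)
Lemma defect_swap a b x : S a -> S b ->
  defect a b * x * (a * b - b * a) + (a * b - b * a) * x * defect a b = 0.
Proof.
move=> Sa Sb.
pose W := tau (a * (b * x * b) * a) + tau (b * (a * x * a) * b).
have EW : W = tau (a * b * x * (b * a) + b * a * x * (a * b)).
  by rewrite /W -tauD; congr tau; ncring.
have Hba := defectC b Sa.
apply: (eq_by_diff (d := (W - tau (a * b * x * (b * a) + b * a * x * (a * b)))
  + (defect b a + defect a b) * x * (a * b) + (a * b) * x * (defect b a + defect a b)
  )).
  by rewrite Hba EW; ncring.
rewrite /W !jordan_triple// jordan_triple_sym; try exact: SMl.
rewrite /defect; ncring.
Qed.

(** [defect_swap] and [semiprime_swap] give defect a b * x * [a, b] = 0; polarising in a and then in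
    b separates the two pairs. *)
Lemma defect_mul_commutator a b d e x : S a -> S b -> S d -> S e ->
  defect a b * x * (d * e - e * d) = 0.
Proof.
have H1 a1 b1 : S a1 -> S b1 ->
    forall x, defect a1 b1 * x * (a1 * b1 - b1 * a1) = 0.
  by move=> Sa Sb; apply: semiprime_swap => y; exact: defect_swap.
have H2 a1 b1 d1 : S a1 -> S b1 -> S d1 ->
    forall x, defect a1 b1 * x * (d1 * b1 - b1 * d1) = 0.
  move=> Sa Sb Sd; apply: (semiprime_polarize (v := defect d1 b1) (H1 _ _ Sa Sb)) => y.
  apply: (eq_by_diff (d := defect (a1 + d1) b1 * y * ((a1 + d1) * b1 - b1 * (a1 + d1))
     - defect a1 b1 * y * (a1 * b1 - b1 * a1) - defect d1 b1 * y * (d1 * b1 - b1 * d1))).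
    by rewrite !H1//; [ncring | exact: SD].
  by rewrite defectDl; ncring.
move=> Sa Sb Sd Se; move: x.
apply: (semiprime_polarize (v := defect a e) (H2 _ _ _ Sa Sb Sd)) => y.
apply: (eq_by_diff (d := defect a (b + e) * y * (d * (b + e) - (b + e) * d)
   - defect a b * y * (d * b - b * d) - defect a e * y * (d * e - e * d))).
  by rewrite !H2//; [ncring | exact: SD].
by rewrite defectDr; ncring.
Qed.

(** For t = [u, e] and x in S, the element t x t is a combination of products that
    contain a factor u [d, e] with d in S. *)
Lemma central_of_annihilator (u : A) :
  (forall x d e, S d -> S e -> u * x * (d * e - e * d) = 0) -> central u.
Proof.
move=> h; apply: central_of_comm => e Se; apply/eqP; rewrite -subr_eq0; apply/eqP.
apply: Ssemiprime => x Sx.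
have Sex : S (e * x) by exact: SMl.
apply: (eq_by_diff (d := u * 1 * (e * x * u * e - e * (e * x * u))
  - u * 1 * (e * x * e - e * (e * x)) * u
  - e * (u * 1 * (x * u * e - e * (x * u)))
  + e * (u * 1 * (x * e - e * x)) * u)).
  by rewrite !h//; [ncring|exact: SMr|exact: SMr].
by ncring.
Qed.

Lemma annihilator_commutator_ext (u a b : A) : central u ->
  (forall d e, S d -> S e -> u * (d * e - e * d) = 0) ->
  S a -> u * (a * b - b * a) = 0.
Proof.
move=> cu h Sa; apply: faithful_left => x Sx.
apply: (eq_by_diff (d := u * (a * (b * x) - b * x * a)
  + (u * b - b * u) * (x * a - a * x) + b * (u * (x * a - a * x)))).
  by rewrite !h ?cu//; [ncring | exact: SMl].
by ncring.
Qed.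

(** The defect u is central and u [a, b] = 0, so that 2 u ^ 2 = u tau [a, b]; the
    Jordan identity for [a, b] and u then gives 4 u ^ 3 = 0. *)
Lemma defect_ideal a b : S a -> S b -> defect a b = 0.
Proof.
move=> Sa Sb; set u := defect a b.
have ucomm x d e : S d -> S e -> u * x * (d * e - e * d) = 0.
  by move=> *; exact: defect_mul_commutator.
have cu := central_of_annihilator ucomm.
have ucomm1 d e : S d -> S e -> u * (d * e - e * d) = 0.
  by move=> Sd Se; rewrite -(ucomm 1 d e)// mulr1.
set c := a * b - b * a.
have Sc : S c by apply: SD; [exact: SMl|apply: SN; exact: SMl].
have uc : u * c = 0 by exact: ucomm1.
have uu : u * u + u * u = u * tau c.
  apply: (eq_by_diff (d := u * (defect b a + defect a b)
     - u * (a * tau b - tau b * a) + u * (b * tau a - tau a * b))).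
    by rewrite (defectC b Sa) !annihilator_commutator_ext//; ncring.
  by rewrite /c tauB /u /defect; ncring.
have tuc : u * (u * tau c) + u * (u * tau c) = 0.
  have E : tau (c * u + u * c) = 0 by rewrite -cu uc addr0 tau0.
  apply: (eq_by_diff (d := u * tau (c * u + u * c)
     - u * c * tau u - (u * (tau u) - tau u * u) * c - tau u * (u * c)
     + u * (u * tau c - tau c * u))).
    by rewrite E uc !cu; ncring.
  by rewrite tauJ//; ncring.
have u3 : u * (u * u) = 0.
  apply: torsion2; apply: torsion2.
  apply: (eq_by_diff (d := u * (u * u + u * u - u * tau c) + u * (u * u + u * u - u * tau c)
    + (u * (u * tau c) + u * (u * tau c)))).
    by rewrite uu subrr tuc; ncring.
  by ncring.
apply: central_nilpotent => //; apply: central_nilpotent.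
  by move=> x; rewrite -mulrA (cu x) mulrA (cu x) -mulrA.
by rewrite -mulrA u3 mulr0.
Qed.

(** Associativity makes the defect a Hochschild cocycle; this is what carries its
    vanishing from the ideal to the whole ring. *)
Lemma defect_cocycle a b c :
  defect (a * b) c + defect a b * c = defect a (b * c) + a * defect b c.
Proof. by rewrite /defect !mulrA; ncring. Qed.

(** For x in S, three instances of the cocycle identity and the antisymmetry of the
    defect give x * defect a b = - (x * defect a b). *)
Lemma defect_ideal_left a b : S a -> defect a b = 0.
Proof.
move=> Sa; apply: faithful_right => x Sx; apply: torsion2.
have Sxa : S (x * a) by exact: SMl.
have xab : x * defect a b = defect (x * a) b.
  have := defect_cocycle x a b.
  by rewrite !(@defect_ideal x)//; [rewrite mul0r addr0 add0r | exact: SMr].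
have bxa : defect b x * a = defect b (x * a).
  have := defect_cocycle b x a.
  by rewrite (defect_ideal Sx Sa) defect_ideal ?mulr0 ?add0r ?addr0//; exact: SMl.
have xba : defect x b * a = x * defect b a.
  have := defect_cocycle x b a.
  by rewrite (@defect_ideal (x * b))// ?(@defect_ideal x (b * a)) ?add0r//;
     [exact: SMl|exact: SMr].
have e : x * defect a b = - (x * defect a b).
  by rewrite {1}xab -(opprK (defect _ _)) -defectC// -bxa (defectC b Sx) mulNr opprK
             xba (defectC b Sa) mulrN.
by rewrite {1}e addNr.
Qed.

(** Herstein's theorem, in Bresar's semiprime form, for maps whose Jordan identity
    is known only when one factor lies in S. *)
Theorem jordan_derivation_is_derivation a b : tau (a * b) = tau a * b + a * tau b.
Proof.
suff d0 : defect a b = 0.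
  by apply: (eq_by_diff d0); rewrite /defect; ncring.
have dr c x : S x -> defect c x = 0.
  by move=> Sx; rewrite defectC// defect_ideal_left// oppr0.
apply: faithful_left => x Sx; have := defect_cocycle a b x.
by rewrite (dr _ x)// (dr _ (b * x)) ?(dr b x)// ?mulr0 ?add0r//; exact: SMl.
Qed.

End JordanDerivation.

(** * Xi-Lie derivations at zero products, over an abstract ring *)

(* z stands for xi times the identity; the invertibility of 1 - xi, and of 1 + xi
   unless xi = - 1, enters only as a cancellation property. *)
Section XiLieDerivation.
Variables (C : A -> Prop) (z : A) (delta : A -> A).
Hypothesis C_central : forall c, C c -> central c.
Hypothesis Cz : C z.
Hypothesis z_neq1 : forall x, x - z * x = 0 -> x = 0.
Hypothesis z_eqN1 : 1 + z = 0 \/ forall x, x + z * x = 0 -> x = 0.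
Hypothesis deltaD : forall a b, delta (a + b) = delta a + delta b.
Hypothesis deltaC : forall c a, C c -> delta (c * a) = c * delta a.

Definition zcomm (a b : A) := a * b - z * (b * a).

Hypothesis deltaL : forall a b, a * b = 0 ->
  delta (zcomm a b) = zcomm (delta a) b + zcomm a (delta b).
Hypothesis S_span : forall x, S x -> idempotent_span C x.

Let delta0 : delta 0 = 0.
Proof. by apply: (addrI (delta 0)); rewrite -deltaD !addr0. Qed.
Let deltaN a : delta (- a) = - delta a.
Proof. by apply: (addrI (delta a)); rewrite -deltaD !subrr. Qed.
Let deltaB a b : delta (a - b) = delta a - delta b.
Proof. by rewrite deltaD deltaN. Qed.

(* The obstruction to the xi-Lie derivation rule: a biadditive map that vanishes
   on zero products. *)
Let psi a b := delta (zcomm a b) - zcomm (delta a) b - zcomm a (delta b).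

Let psiE a b : psi a b = delta (a * b) - z * delta (b * a)
  - (delta a * b - z * (b * delta a)) - (a * delta b - z * (delta b * a)).
Proof. by rewrite /psi {1}/zcomm deltaB (deltaC _ Cz). Qed.

Let psiDl a b c : psi (a + b) c = psi a c + psi b c.
Proof. by rewrite !psiE !mulrDl !mulrDr !deltaD; ncring. Qed.

Let psiDr a b c : psi a (b + c) = psi a b + psi a c.
Proof. by rewrite !psiE !mulrDl !mulrDr !deltaD; ncring. Qed.

Let psiBl a b c : psi (a - b) c = psi a c - psi b c.
Proof. by apply: (canRL (addrK _)); rewrite -psiDl subrK. Qed.

Let psiBr a b c : psi a (b - c) = psi a b - psi a c.
Proof. by apply: (canRL (addrK _)); rewrite -psiDr subrK. Qed.

Let psi_eq0 a b : a * b = 0 -> psi a b = 0.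
Proof. by move=> ab; rewrite /psi deltaL// addrAC addrK subrr. Qed.

Let zcommCl c a b : C c -> zcomm (c * a) b = c * zcomm a b.
Proof.
move=> /C_central cc; rewrite /zcomm mulrBr -mulrA; congr (_ - _).
by rewrite (mulrA b) -(cc b) -mulrA mulrA -(cc z) -mulrA.
Qed.

Let zcommCr c a b : C c -> zcomm a (c * b) = c * zcomm a b.
Proof.
move=> /C_central cc; rewrite /zcomm mulrBr; congr (_ - _).
  by rewrite mulrA -(cc a) mulrA.
by rewrite -mulrA mulrA -(cc z) -mulrA.
Qed.

Let psiC c a b : C c -> psi (c * a) b = psi a (c * b).
Proof. by move=> Cc; rewrite /psi !(zcommCl, zcommCr, deltaC). Qed.

(* For an idempotent e, both (a e) ((1 - e) b) and (a (1 - e)) (e b) are zero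
   products, so psi (a e) b = psi (a e) (e b) = psi a (e b). *)
Let psi_balanced s a b : S s -> psi (a * s) b = psi a (s * b).
Proof.
move=> /S_span; elim=> {s} [x y _ IHx _ IHy|c e Cc ee].
  by rewrite mulrDr mulrDl psiDl psiDr IHx IHy.
have cc := C_central Cc.
have -> : a * (c * e) = c * a * e by rewrite mulrA -(cc a).
rewrite -[c * e * b]mulrA -psiC//.
move: (c * a) => {}a.
have -> : psi (a * e) b = psi (a * e) (e * b).
  apply: (eq_by_diff (d := psi (a * e) (b - e * b))).
    by apply: psi_eq0; rewrite mulrBr !mulrA -(mulrA a e e) ee subrr.
  by rewrite psiBr.
apply: (eq_by_diff (d := - psi (a - a * e) (e * b))).
  by rewrite psi_eq0 ?oppr0// mulrBl !mulrA -(mulrA a e e) ee subrr.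
by rewrite psiBl; ncring.
Qed.

Let Z := delta 1.

Let psi1l b : psi 1 b = - zcomm Z b.
Proof. by rewrite psiE /zcomm !mul1r !mulr1; ncring. Qed.

Let psi1r a : psi a 1 = - zcomm a Z.
Proof. by rewrite psiE /zcomm !mul1r !mulr1; ncring. Qed.

Let psi_idealr a s : S s -> psi a s = - zcomm (a * s) Z.
Proof. by move=> Ss; rewrite -psi1r psi_balanced// mulr1. Qed.

Let psi_ideall s b : S s -> psi s b = - zcomm Z (s * b).
Proof. by move=> Ss; rewrite -psi1l -psi_balanced// mul1r. Qed.

(** Comparing psi r 1 with psi 1 r gives (1 + z) [r, delta 1] = 0. If z = - 1, psi
    is symmetric instead; then delta 1 anticommutes with all commutators [r, b],
    whence [delta 1, r] [r, b] = 0, and b := b delta 1 reaches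
    [delta 1, r] b [r, delta 1] = 0. *)
Lemma delta1_central : central Z.
Proof.
apply: central_of_comm => r Sr; apply/eqP; rewrite -subr_eq0; apply/eqP.
case: z_eqN1 => [zN1|h]; last first.
  apply: h; have := psi_idealr 1 Sr; have := psi_ideall 1 Sr.
  rewrite psi1r mulr1 mul1r psi1l /zcomm => h1 h2.
  apply: (eq_by_diff (d := - (r * Z - z * (Z * r)) - - (Z * r - z * (r * Z)))).
    by rewrite h1 subrr.
  by ncring.
have zE : z = - 1 by apply/eqP; rewrite -addr_eq0 addrC zN1.
have H b : Z * (r * b - b * r) + (r * b - b * r) * Z = 0.
  have := psi_idealr b Sr; have := psi_ideall b Sr.
  have -> : psi b r = psi r b by rewrite !psiE zE; ncring.
  move=> -> E.
  apply: (eq_by_diff (d := - zcomm (b * r) Z - - zcomm Z (r * b))).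
    by rewrite E subrr.
  by rewrite /zcomm zE; ncring.
have H2 b : (Z * r - r * Z) * (r * b - b * r) = 0.
  apply: (eq_by_diff (d := (Z * (r * (r * b) - r * b * r) + (r * (r * b) - r * b * r) * Z)
     - r * (Z * (r * b - b * r) + (r * b - b * r) * Z))).
    by rewrite !H mulr0 subrr.
  by ncring.
apply: Ssemiprime => b _.
apply: (eq_by_diff (d := (Z * r - r * Z) * (r * b - b * r) * Z
   - (Z * r - r * Z) * (r * (b * Z) - b * Z * r))).
  by rewrite !H2 mul0r subrr.
by ncring.
Qed.

(* Adding the values of psi s b and psi b s given by balancedness, all terms
   acquire the common factor 1 - z; what remains after cancelling it is the Jordan
   identity for tau. *)
Let tau a := delta a - Z * a.

Let tauD a b : tau (a + b) = tau a + tau b.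
Proof. by rewrite /tau deltaD; ncring. Qed.

Let tau_jordan a b : S a ->
  tau (a * b + b * a) = tau a * b + a * tau b + (tau b * a + b * tau a).
Proof.
move=> Sa; apply/eqP; rewrite -subr_eq0; apply/eqP; apply: z_neq1.
have Zc := delta1_central.
apply: (eq_by_diff (d := (psi a b - - zcomm Z (a * b)) + (psi b a - - zcomm (b * a) Z)
   - (Z * a - a * Z) * b + b * (Z * a - a * Z)
   - z * (a * (Z * b - b * Z)) + z * ((Z * b - b * Z) * a))).
  by rewrite psi_ideall// psi_idealr// !Zc; ncring.
by rewrite !psiE /tau /zcomm deltaD; ncring.
Qed.

Lemma xi_Lie_generalized_derivation a b :
  delta (a * b) = delta a * b + a * delta b - Z * a * b.
Proof.
have := jordan_derivation_is_derivation tauD tau_jordan a b; rewrite /tau => E.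
apply: (eq_by_diff (d := delta (a * b) - Z * (a * b)
  - ((delta a - Z * a) * b + a * (delta b - Z * b)) - (a * Z - Z * a) * b)).
  by rewrite E -[a * Z]delta1_central; ncring.
by ncring.
Qed.

Lemma xi_Lie_all_products a b : delta (zcomm a b) =
  zcomm (delta a) b + zcomm a (delta b) - Z * zcomm a b.
Proof.
rewrite /zcomm deltaB (deltaC _ Cz) !xi_Lie_generalized_derivation.
apply: (eq_by_diff (d := (z * Z - Z * z) * b * a)); last by ncring.
by rewrite delta1_central subrr !mul0r.
Qed.

(** The two expressions for delta at a zero product, the one assumed and
    [xi_Lie_all_products], differ by exactly this term. *)
Lemma xi_Lie_zero_product a b : a * b = 0 -> Z * zcomm a b = 0.
Proof.
move=> /deltaL; rewrite xi_Lie_all_products => E.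
by apply: (addIr (zcomm (delta a) b + zcomm a (delta b)));
   rewrite add0r -{1}E addrC subrK.
Qed.

(** If a central w acts on x as a scalar c, the derivation rule for w x and for
    c x gives tau w * x = (c - w) tau x. Multiplying by tau w * x * y on the left
    moves c - w next to x, which it kills; so tau w * x = 0 by semiprimeness. *)
Lemma xi_Lie_central_linear (r1 : A -> Prop) :
  (forall a, (forall x, r1 x -> a * x = 0) -> a = 0) ->
  (forall w x, central w -> r1 x -> exists2 c, C c & w * x = c * x) ->
  forall w a, central w -> delta (w * a) = w * delta a.
Proof.
move=> r1_faithful r1_scalar w a cw.
have tauM b c : tau (b * c) = tau b * c + b * tau c.
  exact: jordan_derivation_is_derivation tauD tau_jordan b c.
suff tw : tau w = 0.
  apply: (eq_by_diff (d := tau w * a)); first by rewrite tw mul0r.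
  by rewrite xi_Lie_generalized_derivation /tau; ncring.
apply: r1_faithful => x r1x; apply: Ssemiprime => y _.
have [c Cc wx] := r1_scalar w x cw r1x.
have tc : tau (c * x) = c * tau x.
  rewrite /tau deltaC// mulrBr; congr (_ - _).
  by rewrite !mulrA delta1_central.
have := tauM w x; rewrite wx tc => E.
apply: (eq_by_diff (d := tau w * x * y * (tau w * x + w * tau x - c * tau x)
  - tau w * ((w * x - c * x) * y * tau x)
  + tau w * (w * (x * y) - x * y * w) * tau x
  - tau w * (c * (x * y) - x * y * c) * tau x)).
  by rewrite -E subrr wx subrr cw (C_central Cc); ncring.
by ncring.
Qed.

End XiLieDerivation.
End SemiprimeIdeal.
End NoncommutativeRing.

(** * Hahn-Banach separation over the reals and the complex numbers *)

Section MazurOrlicz.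
Variables (R : realType) (V : lmodType R).

Definition sublinear (p : V -> R) :=
  (forall u v, p (u + v) <= p u + p v) /\
  (forall (t : R) u, 0 <= t -> p (t *: u) <= t * p u).

Lemma sublinear0 p : sublinear p -> p 0 = 0.
Proof.
move=> [pD pZ]; apply/eqP; rewrite eq_le; apply/andP; split.
  by have := pZ 0 0 (lexx 0); rewrite scale0r mul0r.
by have := pD 0 0; rewrite addr0 -subr_ge0 addrK.
Qed.

Lemma sublinear_homogeneous p t u : sublinear p -> 0 <= t -> p (t *: u) = t * p u.
Proof.
move=> sp; have [pD pZ] := sp; rewrite le_eqVlt => /predU1P[<-|t0].
  by rewrite scale0r mul0r sublinear0.
apply/eqP; rewrite eq_le (pZ _ _ (ltW t0))/=.
have := pZ t^-1 (t *: u); rewrite invr_ge0 => /(_ (ltW t0)).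
by rewrite scalerA mulVf ?gt_eqF// scale1r ler_pdivlMl.
Qed.

Lemma sublinear_opp p u : sublinear p -> - p (- u) <= p u.
Proof.
move=> sp; have := sp.1 u (- u); rewrite subrr (sublinear0 sp); lra.
Qed.

(** T encodes a convex cone together with a superlinear function on it, bounded by
    p; it need not be a graph. *)
Definition cone_below (p : V -> R) (T : V -> R -> Prop) :=
  [/\ T 0 0, forall c a d b, T c a -> T d b -> T (c + d) (a + b),
      forall t c a, 0 <= t -> T c a -> T (t *: c) (t * a) &
      forall c a, T c a -> a <= p c].

(** The witness is q u = inf (p (u + c) - a) over the pairs (c, a) in T. The
    bound a <= p c keeps this infimum above - p (- u). *)
Lemma sublinear_cone p T : sublinear p -> cone_below p T ->
  exists q, [/\ sublinear q, forall u, q u <= p u &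
    forall c a u, T c a -> q u <= p (u + c) - a].
Proof.
move=> sp [T0 TD TZ Tp]; have [pD pZ] := sp.
pose E u := [set r | exists c a, T c a /\ r = p (u + c) - a].
have lbE u : lbound (E u) (- p (- u)).
  move=> _ [c [a [Tca ->]]].
  have := pD (u + c) (- u); rewrite [u + c]addrC addrK => h.
  by have := Tp _ _ Tca; lra.
have qle c a u : T c a -> inf (E u) <= p (u + c) - a.
  by move=> Tca; apply: ge_inf; [exists (- p (- u)); exact: lbE | exists c, a].
have qge u r : (forall c a, T c a -> r <= p (u + c) - a) -> r <= inf (E u).
  move=> h; apply: lb_le_inf; first by exists (p (u + 0) - 0), 0, 0.
  by move=> _ [c [a [Tca ->]]]; exact: h.
exists (fun u => inf (E u)); split=> //; last first.
  by move=> u; have := qle _ _ u T0; rewrite addr0 subr0.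
split=> [u v|t u t0].
  rewrite -lerBlDr; apply: (qge) => c a Tca; rewrite lerBlDr -lerBlDl.
  apply: (qge) => d b Tdb; rewrite lerBlDl.
  apply: le_trans (qle _ _ _ (TD _ _ _ _ Tca Tdb)) _.
  by rewrite addrACA; have := pD (u + c) (v + d); lra.
move: t0; rewrite le_eqVlt => /predU1P[<-|t0].
  by have := qle _ _ 0 T0; rewrite addr0 sublinear0// subrr mul0r scale0r.
rewrite -ler_pdivrMl//; apply: (qge) => c a Tca; rewrite ler_pdivrMl//.
apply: le_trans (qle _ _ _ (TZ t _ _ (ltW t0) Tca)) _.
by rewrite -scalerDr (sublinear_homogeneous _ sp (ltW t0)) mulrBr.
Qed.

(** Zorn's lemma: the pointwise infimum of a chain of sublinear functionals is
    sublinear, comparability being used for subadditivity. *)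
Lemma minimal_sublinear p : sublinear p ->
  exists m, [/\ sublinear m, forall u, m u <= p u &
    forall q, sublinear q -> (forall u, q u <= m u) -> q = m].
Proof.
move=> sp; pose T := {q : V -> R | sublinear q /\ forall u, q u <= p u}.
pose below (q r : T) := `[< forall u, sval r u <= sval q u >].
have [q|q r s /asboolP qr /asboolP rs|[q hq] [r hr] /asboolP qr /asboolP rq
  |A tA|[m [sm mp]] mmin] := @Zorn T below.
- exact/asboolP.
- by apply/asboolP => u; exact: le_trans (rs u) (qr u).
- suff E : q = r by subst r; congr (exist _ _ _); exact: Prop_irrelevance.
  by apply/funext => u; apply: le_anti; rewrite (qr u) (rq u).
- have [[q0 Aq0]|A0] := pselect (exists q, A q); last first.
    by exists (exist _ p (conj sp (fun u => lexx _))) => s As; case: A0; exists s.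
  pose E u := [set sval q u | q in A].
  have lbE u : lbound (E u) (- p (- u)).
    move=> _ [[q [sq qp]] _ <-]/=; apply: le_trans (sublinear_opp u sq).
    by rewrite lerN2.
  have ile q u : A q -> inf (E u) <= sval q u.
    by move=> Aq; apply: ge_inf; [exists (- p (- u)); exact: lbE | exists q].
  have lei u r : (forall q, A q -> r <= sval q u) -> r <= inf (E u).
    move=> h; apply: lb_le_inf; first by exists (sval q0 u), q0.
    by move=> _ [q Aq <-]; exact: h.
  have si : sublinear (fun u => inf (E u)).
    split=> [u v|t u t0].
      rewrite -lerBlDr; apply: (lei) => q Aq; rewrite lerBlDr -lerBlDl.
      apply: (lei) => r Ar; rewrite lerBlDl.
      have [/asboolP qr|/asboolP rq] := tA _ _ Aq Ar.
        apply: le_trans (ile _ _ Ar) _; apply: le_trans ((svalP r).1.1 _ _) _.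
        by rewrite lerD2r.
      apply: le_trans (ile _ _ Aq) _; apply: le_trans ((svalP q).1.1 _ _) _.
      by rewrite lerD2l.
    move: t0; rewrite le_eqVlt => /predU1P[<-|t0].
      rewrite mul0r scale0r; apply: le_trans (ile _ _ Aq0) _.
      by rewrite sublinear0//; exact: (svalP q0).1.
    rewrite -ler_pdivrMl//; apply: (lei) => q Aq; rewrite ler_pdivrMl//.
    by apply: le_trans (ile _ _ Aq) _; exact: (svalP q).1.2 _ _ (ltW t0).
  have ip u : inf (E u) <= p u by exact: le_trans (ile _ _ Aq0) ((svalP q0).2 u).
  exists (exist (fun q : V -> R => sublinear q /\ forall u, q u <= p u)
            _ (conj si ip)) => q Aq.
  by apply/asboolP => u; exact: ile.
exists m; split=> // q sq qm.
have qp u : q u <= p u by exact: le_trans (qm u) (mp u).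
have mq := mmin (exist _ q (conj sq qp)) (asboolT qm).
exact: (congr1 sval mq).
Qed.

(** A minimal sublinear functional f is linear: lowering it along the ray through v
    by [sublinear_cone] must not change it, and this says
    f u <= f (u + v) - f v. *)
Theorem mazur_orlicz p T : sublinear p -> cone_below p T ->
  exists f : {linear V -> R^o},
    (forall u, f u <= p u) /\ forall c a, T c a -> a <= f c.
Proof.
move=> sp Tp; have [q [sq qp qT]] := sublinear_cone sp Tp.
have [f [sf fq fmin]] := minimal_sublinear sq.
have fD u v : f (u + v) = f u + f v.
  apply: le_anti; rewrite sf.1/=.
  (* the ray through v, with the values of f on it *)
  pose T' c a := exists2 t, 0 <= t & c = t *: v /\ a = t * f v.
  have [|r [sr rf rT]] := @sublinear_cone f T' sf.
    split.
    - by exists 0 => //; rewrite scale0r mul0r.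
    - move=> _ _ _ _ [s s0 [-> ->]] [t t0 [-> ->]]; exists (s + t).
        exact: addr_ge0.
      by rewrite scalerDl mulrDl.
    - move=> s _ _ s0 [t t0 [-> ->]]; exists (s * t); first exact: mulr_ge0.
      by rewrite scalerA mulrA.
    - by move=> _ _ [t t0 [-> ->]]; rewrite sublinear_homogeneous.
  rewrite -lerBrDr -[in leLHS](fmin r sr rf).
  by apply: rT; exists 1; rewrite ?scale1r ?mul1r.
have fN u : f (- u) = - f u.
  by apply/eqP; rewrite -subr_eq0 opprK -fD addNr sublinear0.
have fl : linear (f : V -> R^o).
  move=> t u v; rewrite fD; congr (_ + _); have [t0|t0] := leP 0 t.
    exact: sublinear_homogeneous.
  by apply: oppr_inj; rewrite -fN -scaleNr sublinear_homogeneous ?oppr_ge0 ?ltW// mulNr.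
pose f_linear := GRing.isLinear.Build _ _ _ _ (f : V -> R^o) fl.
pose g : {linear V -> R^o} := HB.pack (f : V -> R^o) f_linear.
exists g; split.
- by move=> u; exact: le_trans (fq u) (qp u).
- move=> c a Tca; rewrite -lerN2 -fN; apply: le_trans (fq _) _.
  by apply: le_trans (qT _ _ _ Tca) _; rewrite addNr sublinear0// sub0r.
Qed.

End MazurOrlicz.

Section HahnBanach.
Variable R : realType.

(** The cone consists of t x0 + m with t >= 0 and m in M, with value t e. It
    contains M with value 0, and M is a subspace, so f vanishes on M. *)
Lemma hahn_banach_real_functional (V : lmodType R) (p : V -> R) (M : set V)
    (x0 : V) (e : R) :
  sublinear p -> (forall u, 0 <= p u) -> M 0 ->
  (forall (t : R) u v, M u -> M v -> M (t *: u + v)) ->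
  (forall m, M m -> e <= p (x0 + m)) ->
  exists f : {linear V -> R^o}, [/\ forall u, f u <= p u,
    forall m, M m -> f m = 0 & e <= f x0].
Proof.
move=> sp p0 M0 ML ep.
have MD u v : M u -> M v -> M (u + v) by rewrite -{2}(scale1r u); exact: ML.
have MZ t u : M u -> M (t *: u) by move=> Mu; rewrite -(addr0 (_ *: _)); exact: ML.
pose T c a := exists t m, [/\ 0 <= t, M m, c = t *: x0 + m & a = t * e].
have [|f [fp fT]] := @mazur_orlicz _ _ p T sp.
  split.
  - by exists 0, 0; rewrite scale0r mul0r addr0.
  - move=> _ _ _ _ [s [m [s0 Mm -> ->]]] [t [n [t0 Mn -> ->]]].
    exists (s + t), (m + n); split; [exact: addr_ge0|exact: MD| |by rewrite mulrDl].
    by rewrite scalerDl addrACA.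
  - move=> s _ _ s0 [t [m [t0 Mm -> ->]]]; exists (s * t), (s *: m).
    split; [exact: mulr_ge0|exact: MZ| |by rewrite mulrA].
    by rewrite scalerDr scalerA.
  - move=> _ _ [t [m [t0 Mm -> ->]]].
    move: t0; rewrite le_eqVlt => /predU1P[<-|t0]; first by rewrite mul0r p0.
    have -> : t *: x0 + m = t *: (x0 + t^-1 *: m).
      by rewrite scalerDr scalerA mulfV ?gt_eqF// scale1r.
    rewrite (sublinear_homogeneous _ sp (ltW t0)) ler_pM2l//.
    by apply: ep; exact: MZ.
have fM m : M m -> 0 <= f m.
  by move=> Mm; apply: fT; exists 0, m; rewrite scale0r mul0r add0r.
exists f; split=> //.
- move=> m Mm; apply: le_anti; rewrite fM// andbT -oppr_ge0.
  rewrite -linearN.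
  by apply: fM; rewrite -scaleN1r; exact: MZ.
- by apply: fT; exists 1, 0; rewrite scale1r mul1r addr0.
Qed.

Lemma closed_subspace_gap (F : numFieldType) (X : normedModType F) (M : set X) (x0 : X) :
  is_subspace M -> closed M -> ~ M x0 ->
  exists2 e : F, 0 < e & forall m, M m -> e <= `|x0 + m|.
Proof.
move=> [M0 ML] Mcl Mx0.
have : nbhs x0 (~` M) by apply: open_nbhs_nbhs; split => //; exact: closed_openC.
move=> /nbhs_ballP[e /= e0 be]; exists e => // m Mm.
rewrite real_leNgt ?(gtr0_real e0) ?normr_real//; apply/negP => lt_e.
apply: (be (- m)) => /=; first by rewrite -ball_normE /= opprK.
by rewrite -scaleN1r -(addr0 (_ *: _)); exact: ML.
Qed.

Definition has_separating_functionals (F : numFieldType) :=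
  forall (X : normedModType F) (M : set X) (x0 : X),
  is_subspace M -> closed M -> ~ M x0 ->
  exists f : {linear X -> F^o}, [/\ exists r : F, forall x, `|f x| <= r * `|x|,
    forall m, M m -> f m = 0 & f x0 = 1].

Lemma separating_of_nonzero (F : numFieldType) (X : normedModType F) (M : set X) (x0 : X)
   (f : {linear X -> F^o}) (r : F) :
  (forall x, `|f x| <= r * `|x|) -> (forall m, M m -> f m = 0) -> f x0 <> 0 ->
  exists f : {linear X -> F^o}, [/\ exists r : F, forall x, `|f x| <= r * `|x|,
    forall m, M m -> f m = 0 & f x0 = 1].
Proof.
move=> fr fM /eqP fx0.
pose g := ((f x0)^-1 : F) \*: f.
exists g; split.
- exists (`|(f x0)^-1| * r) => x; rewrite /g/= normrZ -mulrA ler_wpM2l//.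
- by move=> m Mm; rewrite /g/= (fM m Mm) scaler0.
- by rewrite /g/=; exact: mulVf.
Qed.

Lemma separating_functionals_real : has_separating_functionals R.
Proof.
move=> X M x0 Msub Mcl Mx0; have [e e0 He] := closed_subspace_gap Msub Mcl Mx0.
have [M0 ML] := Msub.
have sn : sublinear (fun x : X => `|x|).
  by split=> [u v|t u t0]; [exact: ler_normD | rewrite normrZ ger0_norm].
have [f [fp fM fx0]] := hahn_banach_real_functional sn (fun u => normr_ge0 u) M0 ML He.
apply: (@separating_of_nonzero _ _ _ _ f 1) => //; last first.
  by apply/eqP; rewrite gt_eqF// (lt_le_trans e0).
move=> x; rewrite mul1r ler_norml fp andbT lerNl -linearN.
by apply: le_trans (fp _) _; rewrite normrN.
Qed.

(** The underlying real vector space; the new name is what selects the real scalar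
    multiplication. *)
Definition realified (X : lmodType R[i]) : Type := X.

Section Realified.
Variable X : lmodType R[i].
HB.instance Definition _ := GRing.Zmodule.copy (realified X) X.

Let rscale (t : R) (x : realified X) : realified X := (t%:C)%C *: (x : X).

Fact rscaleA a b x : rscale a (rscale b x) = rscale (a * b) x.
Proof. by rewrite /rscale scalerA -rmorphM. Qed.
Fact rscale1 : left_id 1 rscale.
Proof. by move=> x; rewrite /rscale scale1r. Qed.
Fact rscaleDr : right_distributive rscale +%R.
Proof. by move=> a x y; rewrite /rscale scalerDr. Qed.
Fact rscaleDl x : {morph rscale^~ x : a b / a + b}.
Proof. by move=> a b; rewrite /rscale rmorphD scalerDl. Qed.

HB.instance Definition _ := GRing.Zmodule_isLmodule.Build R (realified X)
  rscaleA rscale1 rscaleDr rscaleDl.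

Lemma realified_scaleE (t : R) (x : realified X) : t *: x = (t%:C)%C *: (x : X).
Proof. by []. Qed.

End Realified.

(** Bohnenblust and Sobczyk: a real functional g on the underlying real space is the
    real part of the complex functional u |-> g u - i g (i u). *)
Lemma separating_functionals_complex : has_separating_functionals R[i].
Proof.
move=> X M x0 Msub Mcl Mx0; have [e e0 He] := closed_subspace_gap Msub Mcl Mx0.
have [M0 ML] := Msub.
pose V := realified X.
pose p (x : V) : R := complex.Re `|x : X|.
have pE (x : X) : ((p x)%:C)%C = `|x| by rewrite /p RRe_real// normr_real.
have p0 u : 0 <= p u by rewrite -ler0c pE.
have sp : sublinear p.
  split=> [u v|t u t0]; first by rewrite -lecR rmorphD/= !pE ler_normD.
  rewrite -lecR rmorphM/= !pE realified_scaleE normrZ ger0_norm//.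
  by rewrite ler0c.
have eE : ((complex.Re e)%:C)%C = e by rewrite RRe_real// gtr0_real.
have ep m : M m -> complex.Re e <= p ((x0 : V) + m) by rewrite -lecR eE pE; exact: He.
(* from here on g is a map on X, on which only the complex scalars act *)
have [g [gD gZr gp gM gx0]] : exists g : X -> R,
    [/\ forall u v, g (u + v) = g u + g v,
      forall (t : R) u, g ((t%:C)%C *: u) = t * g u, forall u, g u <= p u,
      forall m, M m -> g m = 0 & complex.Re e <= g x0].
  have [g [gp gM gx0]] := @hahn_banach_real_functional V p M x0 (complex.Re e) sp p0 M0
    (fun t => ML (t%:C)%C) ep.
  by exists g; split=> //; [exact: (linearD g) | move=> t u; exact: (linearZZ g t)].
have gN u : g (- u) = - g u.
  by have := gZr (- 1) u; rewrite rmorphN1 scaleN1r mulN1r.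
pose f (u : X) : R[i] := Complex (g u) (- g ('i%C *: u)).
have iX (u : X) : 'i%C *: ('i%C *: u) = - u by rewrite scalerA -expr2 sqr_i scaleN1r.
have gZ (a b : R) (u : X) : g (Complex a b *: u) = a * g u + b * g ('i%C *: u).
  rewrite (complexE (Complex a b))/= ['i%C * _]mulrC scalerDl -scalerA.
  by rewrite gD !gZr.
have fl : linear (f : X -> R[i]^o).
  move=> [a b] u v; rewrite /f.
  have -> : g (Complex a b *: u + v) = a * g u - b * - g ('i%C *: u) + g v.
    by rewrite gD gZ mulrN opprK.
  have -> : - g ('i%C *: (Complex a b *: u + v)) =
      a * - g ('i%C *: u) + b * g u - g ('i%C *: v).
    rewrite scalerDr scalerA [_ * Complex a b]mulrC -scalerA gD gZ iX gN.
    by rewrite opprD opprD !mulrN opprK.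
  by [].
pose f_linear := GRing.isLinear.Build _ _ _ _ (f : X -> R[i]^o) fl.
pose h : {linear X -> R[i]^o} := HB.pack (f : X -> R[i]^o) f_linear.
have gnorm (u : X) : `|g u| <= p u.
  rewrite ler_norml gp andbT lerNl -gN; apply: le_trans (gp _) _.
  by rewrite -lecR !pE normrN.
apply: (@separating_of_nonzero _ _ _ _ h 2).
- have normR (r : R) : `|(r%:C)%C| = ((`|r|)%:C)%C :> R[i].
    by rewrite normc_def/= expr0n addr0 sqrtr_sqr.
  have normi : `|'i%C| = 1 :> R[i].
    by rewrite normc_def/= expr0n add0r expr1n sqrtr1.
  have gnormC u : `|((g u)%:C)%C| <= `|u| by rewrite normR -pE lecR gnorm.
  move=> x; have -> : h x = ((g x)%:C)%C - 'i%C * ((g ('i%C *: x))%:C)%C :> R[i].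
    by rewrite -mulrN -rmorphN; exact: complexE.
  apply: le_trans (ler_normB _ _) _; rewrite normrM normi mul1r mulr_natl mulr2n.
  apply: lerD => //; apply: le_trans (gnormC _) _.
  by rewrite normrZ normi mul1r.
- move=> m Mm; rewrite /h/= /f !gM//; first by rewrite oppr0.
  by rewrite -(addr0 (_ *: _)); exact: ML.
- by rewrite /h/= /f => -[gx0' _]; move: e0; rewrite -eE ltcR ltNge -gx0' gx0.
Qed.

End HahnBanach.

Lemma separating_functionals (R : realType) (F : numFieldType) :
  real_or_complex R F -> has_separating_functionals F.
Proof.
case; [exact: separating_functionals_real|exact: separating_functionals_complex].
Qed.

(** * Rank-one operators in the algebra of a J-subspace lattice *)

Section RankOne.
Variables (F : numFieldType) (X : normedModType F) (L : subspace_lattice X).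
Hypotheses (hL : is_Jlattice L) (hF : has_separating_functionals F).

Lemma alg_linear (a : alg L) : linear a.
Proof. by have /is_algP[[]] := algvalP a. Qed.

Lemma algD (a : alg L) u v : a (u + v) = a u + a v.
Proof. by have := alg_linear a 1 u v; rewrite !scale1r. Qed.

Lemma alg0 (a : alg L) : a 0 = 0.
Proof. by apply: (addrI (a 0)); rewrite -algD !addr0. Qed.

Lemma algZ (a : alg L) t u : a (t *: u) = t *: a u.
Proof. by have := alg_linear a t u 0; rewrite !addr0 alg0 addr0. Qed.

Lemma algM (a b : alg L) x : (a * b) x = a (b x).
Proof. by []. Qed.

Lemma alg_scale (a : alg L) t x : (t *: a) x = t *: a x.
Proof. by []. Qed.

Lemma alg_add (a b : alg L) x : (a + b) x = a x + b x.
Proof. by []. Qed.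

Lemma alg_bounded (a : alg L) : exists2 r : F, 0 <= r & forall x, `|a x| <= r * `|x|.
Proof.
have /is_algP[[_ [r ar]] _] := algvalP a; exists `|r| => // x.
rewrite -[`|x|]normr_id -normrM (le_trans (ar x))// real_ler_norm//.
by rewrite ger0_real// (le_trans _ (ar x)).
Qed.

Lemma alg_inv (a : alg L) M x : sublat L M -> M x -> M (a x).
Proof. by have /is_algP[_ aL] := algvalP a; move=> /aL; apply. Qed.

Lemma algP (a b : alg L) : (forall x, a x = b x) -> a = b.
Proof. by move=> ab; apply: val_inj; exact/funext. Qed.

Lemma alg_closed_ker (a : alg L) : closed [set x | a x = 0].
Proof.
have [r r0 ar] := alg_bounded a; move=> y ycl; apply: contrapT => /eqP ay.
have e0 : 0 < `|a y| / (r + 1) by rewrite divr_gt0 ?normr_gt0// ltr_wpDl.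
have [x [/= ax]] := ycl _ (nbhsx_ballx y _ e0).
rewrite -ball_normE/= => yx.
have : `|a y| <= r * `|y - x|.
  by have := ar (y - x); rewrite -scaleN1r algD algZ ax scaler0 addr0.
apply/negP; rewrite -real_ltNge ?ger0_real// ?mulr_ge0//.
have : (r + 1) * `|y - x| < `|a y| by rewrite mulrC -ltr_pdivlMr// ltr_wpDl.
by apply: le_lt_trans; rewrite ler_wpM2r// lerDl.
Qed.

(** The kernel is a closed subspace and the members of J span a dense one. *)
Lemma alg_eq0 (a : alg L) :
  (forall K x, Jset L K -> K x -> a x = 0) -> a = 0.
Proof.
move=> h; apply: algP => x; have : [set: X] x by [].
rewrite -(Jlattice_join hL) /closed_span => /closureS H.
apply: (alg_closed_ker (a := a)); apply: H; apply: smallest_sub => /=.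
  split; first exact: alg0.
  by move=> t u v /= au av; rewrite algD algZ au av scaler0 addr0.
by move=> y [K JK Ky]; exact: h Ky.
Qed.

Definition annihilator_functional (K : set X) (f : {linear X -> F^o}) :=
  (exists r : F, forall x, `|f x| <= r * `|x|) /\ forall m, lower L K m -> f m = 0.

Lemma sublat_lower K : sublat L (lower L K).
Proof. by apply: sublat_join => M []. Qed.

(** K meets its lower neighbour only in 0, so a nonzero x in K lies outside that
    closed subspace. *)
Lemma separate_in_J K x : Jset L K -> K x -> x <> 0 ->
  exists2 f, annihilator_functional K f & f x = 1.
Proof.
move=> JK Kx x0; have Ll := sublat_lower K.
have [|f [fb fl fx]] := hF (sublat_subspace Ll) (sublat_closed Ll) (x0 := x).
  by move=> lx; apply: x0; have : (K `&` lower L K) x by []; rewrite Jlattice_meetK.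
by exists f.
Qed.

Definition rank_one (T : alg L) := exists K x f,
  [/\ Jset L K, K x, annihilator_functional K f & forall y, T y = f y *: x].

(** Let M be in L. If M contains K, it contains the range; otherwise M is one of the
    spaces spanning the lower neighbour of K, and f vanishes on M. *)
Lemma rank_one_exists K x (f : {linear X -> F^o}) : Jset L K -> K x ->
  annihilator_functional K f -> exists T : alg L, forall y, T y = f y *: x.
Proof.
move=> JK Kx [[r fr] fl]; suff TL : (fun y => f y *: x) \in is_alg L by exists (Alg TL).
apply/is_algP; split.
  split=> [t u v|]; first by rewrite linearP scalerDl scalerA.
  exists (r * `|x|) => y; rewrite normrZ mulrAC ler_wpM2r//.
move=> M LM y My; have [M0 ML] := sublat_subspace LM.
have [KM|KM] := pselect (K `<=` M).
  by rewrite -(addr0 (_ *: _)); apply: ML => //; exact: KM.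
rewrite fl ?scale0r//; apply: subset_closure => N [_ NM]; apply: NM.
by exists M.
Qed.

Lemma rank_one_mull a T : rank_one T -> rank_one (a * T).
Proof.
move=> [K [x [f [JK Kx Kf Tf]]]]; exists K, (a x), f; split=> //.
  by apply: alg_inv Kx; case: JK.
by move=> y; rewrite -algZ -Tf.
Qed.

Lemma rank_one_mulr T a : rank_one T -> rank_one (T * a).
Proof.
move=> [K [x [f [JK Kx [[r fr] fl] Tf]]]].
have fal : linear (fun y => f (a y) : F^o) by move=> t u v; rewrite alg_linear linearP.
pose fa_linear := GRing.isLinear.Build _ _ _ _ (fun y => f (a y) : F^o) fal.
pose fa : {linear X -> F^o} := HB.pack (fun y => f (a y) : F^o) fa_linear.
exists K, x, fa; split=> //; last by move=> y; exact: Tf.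
split=> [|m Km]; last first.
  by apply: fl; apply: alg_inv Km; exact: sublat_lower.
have [s s0 as_] := alg_bounded a; exists (`|r| * s) => y.
apply: le_trans (fr _) _; rewrite -mulrA.
apply: (@le_trans _ _ (`|r| * `|a y|)); last by rewrite ler_wpM2l.
apply: (@le_trans _ _ `|r * `|a y| |); last by rewrite normrM normr_id.
by rewrite real_ler_norm// ger0_real// (le_trans _ (fr _)).
Qed.

Inductive rank_one_span : alg L -> Prop :=
| RankOneSpan1 T : rank_one T -> rank_one_span T
| RankOneSpanD S T : rank_one_span S -> rank_one_span T -> rank_one_span (S + T).

Lemma rank_one_span_mull a T : rank_one_span T -> rank_one_span (a * T).
Proof.
elim=> [{}T rT|S {}T _ IHS _ IHT]; first by apply: RankOneSpan1; exact: rank_one_mull.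
by rewrite mulrDr; exact: RankOneSpanD.
Qed.

Lemma rank_one_span_mulr T a : rank_one_span T -> rank_one_span (T * a).
Proof.
elim=> [{}T rT|S {}T _ IHS _ IHT]; first by apply: RankOneSpan1; exact: rank_one_mulr.
by rewrite mulrDl; exact: RankOneSpanD.
Qed.

(** If a x is nonzero, choose f with f (a x) = 1 and let T be the operator
    y |-> f y x: then a T a maps x to a x. *)
Lemma rank_one_semiprime (a : alg L) :
  (forall T, rank_one_span T -> a * T * a = 0) -> a = 0.
Proof.
move=> h; apply: alg_eq0 => K x JK Kx; apply: contrapT => ax.
have Kax : K (a x) by apply: alg_inv Kx; case: JK.
have [f Kf fax] := separate_in_J JK Kax ax.
have [T Tf] := rank_one_exists JK Kx Kf.
have /h aTa : rank_one_span T by apply: RankOneSpan1; exists K, x, f.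
apply: ax; have : (a * T * a) x = 0 by rewrite aTa.
by rewrite !algM Tf algZ fax scale1r.
Qed.

Lemma rank_one_faithful (a : alg L) : (forall T, rank_one T -> a * T = 0) -> a = 0.
Proof.
move=> h; apply: rank_one_semiprime => T rT; suff -> : a * T = 0 by rewrite mul0r.
by elim: rT => [{}T /h//|S {}T _ IHS _ IHT]; rewrite mulrDr IHS IHT addr0.
Qed.

Definition scalar_alg (c : alg L) := exists t : F, c = t *: (1 : alg L).

Lemma alg_scaleE t (a : alg L) : t *: (1 : alg L) * a = t *: a.
Proof. exact: algP. Qed.

Lemma scalar_central c : scalar_alg c -> central c.
Proof. by move=> [t ->] a; apply: algP => x; rewrite [RHS]algZ. Qed.

Lemma rank_one_idempotent K x (f : {linear X -> F^o}) : Jset L K -> K x ->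
  annihilator_functional K f -> f x = 1 ->
  exists2 e : alg L, e * e = e & forall y, e y = f y *: x.
Proof.
move=> JK Kx Kf fx; have [e ef] := rank_one_exists JK Kx Kf; exists e => //.
by apply: algP => y; rewrite algM !ef linearZZ fx; congr (_ *: _); exact: mulr1.
Qed.

(** With g x = 1, the rank-one operator of x and f is that of
    x and h = f + (1 - f x) g, plus (f x - 1) times that of x and g; both of these
    are idempotent because h x = g x = 1. *)
Lemma rank_one_span_idempotent T :
  rank_one_span T -> idempotent_span scalar_alg T.
Proof.
elim=> [{}T [K [x [f [JK Kx Kf Tf]]]]|S {}T _ IHS _ IHT]; last exact: IdempotentSpanD.
have [x0|/eqP x0] := eqVneq x 0.
  have -> : T = (0 *: (1 : alg L)) * 1.
    by apply: algP => y; rewrite Tf x0 scaler0 mulr1 scale0r.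
  by apply: IdempotentSpanZ; [exists 0|rewrite mulr1].
have [g Kg gx] := separate_in_J JK Kx x0.
have [e2 e2e e2E] := rank_one_idempotent JK Kx Kg gx.
pose h : {linear X -> F^o} := f \+ ((1 - f x) \*: g).
have Kh : annihilator_functional K h.
  split=> [|m Km]; last by rewrite /h/= Kf.2// Kg.2// scaler0 addr0.
  have [[r fr] _] := Kf; have [[s gs] _] := Kg; exists (r + `|1 - f x| * s) => y.
  rewrite /h/= (le_trans (ler_normD _ _))// mulrDl lerD//.
  by rewrite normrZ -mulrA ler_wpM2l.
have [|e1 e1e e1E] := rank_one_idempotent JK Kx Kh.
  rewrite /h/= gx; transitivity (f x + (1 - f x) * 1) => //.
  by rewrite mulr1 addrC subrK.
have -> : T = 1 *: (1 : alg L) * e1 + (f x - 1) *: (1 : alg L) * e2.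
  apply: algP => y; rewrite !alg_scaleE scale1r Tf.
  rewrite alg_add alg_scale e1E e2E /h/= scalerA -scalerDl.
  by congr (_ *: _); rewrite -[_ *: _]/(_ * _); ring.
by apply: IdempotentSpanD; apply: IdempotentSpanZ => //; eexists.
Qed.

(** w commutes with a rank-one idempotent whose range is the line of x; hence x is
    an eigenvector of w. *)
Lemma central_scalar_on_rank_one (w T : alg L) : central w -> rank_one T ->
  exists2 c, scalar_alg c & w * T = c * T.
Proof.
move=> cw [K [x [f [JK Kx Kf Tf]]]].
have [x0|/eqP x0] := eqVneq x 0.
  exists 0; first by exists 0; rewrite scale0r.
  by apply: algP => y; rewrite algM Tf x0 scaler0 alg0 mul0r.
have [g Kg gx] := separate_in_J JK Kx x0.
have [e _ eE] := rank_one_idempotent JK Kx Kg gx.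
have wx : w x = g (w x) *: x.
  have := congr1 (fun a : alg L => a x) (cw e).
  by rewrite !algM !eE gx scale1r.
exists (g (w x) *: (1 : alg L)); first by exists (g (w x)).
apply: algP => y; rewrite alg_scaleE algM alg_scale Tf algZ [in LHS]wx.
by rewrite !scalerA mulrC.
Qed.

End RankOne.

Lemma lmod_mulrnI (F : numFieldType) (V : lmodType F) n (a b : V) :
  a *+ n.+1 = b *+ n.+1 -> a = b.
Proof.
have n0 : n.+1%:R != 0 :> F by rewrite pnatr_eq0.
by move=> e; apply: (scalerI n0); rewrite !scaler_nat.
Qed.

(** * The structure of xi-Lie derivations at zero products *)

Section LieStructure.
Variables (F : numFieldType) (X : normedModType F) (L : subspace_lattice X).
Hypotheses (hL : is_Jlattice L) (hF : has_separating_functionals F).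
Variables (xi : F) (hxi : xi <> 1).
Implicit Types (a b w : alg L) (d : {linear alg L -> alg L}).

Definition xi_Lie_at_zero_products (d : {linear alg L -> alg L}) :=
  forall a b, a * b = 0 -> d (xi_comm xi a b) = xi_comm xi (d a) b + xi_comm xi a (d b).

Lemma xi_commE a b : xi_comm xi a b = zcomm (xi *: (1 : alg L)) a b.
Proof. by rewrite /zcomm alg_scaleE. Qed.

(** These four properties are all that the passage to higher derivations uses. They
    record, on xi-commutators, that d is the multiplication by the central element
    d 1 plus a derivation that kills the centre, and that this multiplication
    annihilates the xi-commutators of zero products. *)
Definition twisted_xi_Lie (d : {linear alg L -> alg L}) :=
  [/\ forall a b, d (xi_comm xi a b) =
        xi_comm xi (d a) b + xi_comm xi a (d b) - d 1 * xi_comm xi a b,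
      forall a b, a * b = 0 -> d 1 * xi_comm xi a b = 0,
      central (d 1) &
      forall w a, central w -> d (w * a) = w * d a].

Theorem xi_Lie_structure d : xi_Lie_at_zero_products d -> twisted_xi_Lie d.
Proof.
move=> dL.
have SD := @RankOneSpanD F X L.
have SMl := @rank_one_span_mull F X L.
have SMr a b : rank_one_span a -> rank_one_span (a * b).
  exact: rank_one_span_mulr.
have Ssp := rank_one_semiprime hL hF.
have tors (a : alg L) : a + a = 0 -> a = 0.
  by move=> aa; apply: (@lmod_mulrnI F _ 1); rewrite mul0rn mulr2n.
have Cc := @scalar_central F X L.
have Cz : scalar_alg (xi *: (1 : alg L)) by exists xi.
have z1 (a : alg L) : a - xi *: (1 : alg L) * a = 0 -> a = 0.
  rewrite alg_scaleE -{1}(scale1r a) -scalerBl.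
  move=> /(congr1 ( *:%R ((1 - xi)^-1 : F))).
  rewrite scalerA mulVf ?scale1r ?scaler0//.
  by rewrite subr_eq0; apply/eqP => /esym.
have zN1 : 1 + xi *: (1 : alg L) = 0 \/
    forall a : alg L, a + xi *: (1 : alg L) * a = 0 -> a = 0.
  have [xi1|xi1] := eqVneq (1 + xi) 0; [left|right=> a].
    by rewrite -{1}(scale1r (1 : alg L)) -scalerDl xi1 scale0r.
  rewrite alg_scaleE -{1}(scale1r a) -scalerDl.
  move=> /(congr1 ( *:%R ((1 + xi)^-1 : F))).
  by rewrite scalerA mulVf// scale1r scaler0.
have dC c a : scalar_alg c -> d (c * a) = c * d a.
  by move=> [t ->]; rewrite !alg_scaleE linearZZ.
have dZ a b : a * b = 0 -> d (zcomm (xi *: (1 : alg L)) a b) =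
    zcomm (xi *: (1 : alg L)) (d a) b + zcomm (xi *: (1 : alg L)) a (d b).
  by rewrite -!xi_commE; exact: dL.
have Sid := rank_one_span_idempotent hL hF.
have dD := linearD d.
split.
- move=> a b; rewrite !xi_commE.
  exact: (xi_Lie_all_products SD SMl SMr Ssp tors Cc Cz z1 zN1 dD dC dZ Sid).
- move=> a b ab; rewrite !xi_commE.
  exact: (xi_Lie_zero_product SD SMl SMr Ssp tors Cc Cz z1 zN1 dD dC dZ Sid).
- exact: (delta1_central SMl Ssp Cc Cz zN1 dD dC dZ Sid).
- exact: (xi_Lie_central_linear SD SMl SMr Ssp tors Cc Cz z1 zN1 dD dC dZ Sid
    (rank_one_faithful hL hF) (central_scalar_on_rank_one hL hF)).
Qed.

End LieStructure.

Lemma linear_ext (R : pzRingType) (U V : lmodType R) (f g : {linear U -> V}) :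
  f =1 g -> f = g.
Proof.
case: f => f [[f1] [f2]]; case: g => g [[g1] [g2]] /= /funext fg; subst g.
by congr (GRing.Linear.Pack (GRing.Linear.Class _ _)); congr (_ _); exact: Prop_irrelevance.
Qed.

(** Sequences below are sequences of linear maps, defined by recursions that refer
    to all earlier terms. *)
Lemma course_of_values (T : Type) (step : nat -> (nat -> T) -> T) :
  (forall n f g, (forall k, (k < n)%N -> f k = g k) -> step n f = step n g) ->
  T -> exists f, forall n, f n = step n f.
Proof.
move=> step_ext t0.
pose fix approx n := if n is m.+1 then
  fun k => if (k < m)%N then approx m k else step m (approx m) else fun=> t0.
have approxE n k : (k < n)%N -> approx n k = step k (approx k).
  elim: n k => // n IH k; rewrite ltnS leq_eqVlt => /predU1P[->|kn] /=.
    by rewrite ltnn.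
  by rewrite kn IH.
exists (fun n => step n (approx n)) => n; apply: step_ext => k kn.
exact: approxE.
Qed.

(** Both sides sum f k i j over all triples with k + 1 + i + j = n. *)
Lemma triangular_convolution (V : nmodType) (f : nat -> nat -> nat -> V) n :
  \sum_(i < n.+1) \sum_(k < i) f k (i - k.+1)%N (n - i)%N =
  \sum_(k < n) \sum_(i < (n - k.+1).+1) f k i (n - k.+1 - i)%N.
Proof.
under eq_bigr => i _.
  rewrite (big_ord_widen n (fun k => f k (i - k.+1)%N (n - i)%N)); last by rewrite -ltnS.
  over.
rewrite (exchange_big_dep xpredT)//=; apply: eq_bigr => k _.
rewrite -subSn// subSS.
transitivity (\sum_(k.+1 <= i < n.+1) f k (i - k.+1)%N (n - i)%N).
  by rewrite big_geq_mkord.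
rewrite -{1}(add0n k.+1) big_addn subSS big_mkord; apply: eq_bigr => i _.
by rewrite addnK addnC subnDA.
Qed.

(** * Higher derivations and their logarithmic derivatives *)

Section Correspondence.
Variables (F : numFieldType) (X : normedModType F) (L : subspace_lattice X).
Variables (xi : F).
Implicit Types (a b c w x y : alg L) (D d : nat -> {linear alg L -> alg L}).

Local Notation "[[ a , b ]]" := (xi_comm xi a b) (at level 0, a, b at level 99).

Lemma xi_commDl a b c : [[a + b, c]] = [[a, c]] + [[b, c]].
Proof. by rewrite /xi_comm mulrDl mulrDr scalerDr opprD addrACA. Qed.

Lemma xi_commDr a b c : [[c, a + b]] = [[c, a]] + [[c, b]].
Proof. by rewrite /xi_comm mulrDl mulrDr scalerDr opprD addrACA. Qed.

Lemma xi_comm0l c : [[0, c]] = 0.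
Proof. by apply: (addrI [[0, c]]); rewrite -xi_commDl !addr0. Qed.

Lemma xi_comm0r c : [[c, 0]] = 0.
Proof. by apply: (addrI [[c, 0]]); rewrite -xi_commDr !addr0. Qed.

Lemma xi_comm_suml n (f : 'I_n -> alg L) c : [[\sum_i f i, c]] = \sum_i [[f i, c]].
Proof.
by apply: (big_morph (fun a => [[a, c]])); [move=> x y; exact: xi_commDl|exact: xi_comm0l].
Qed.

Lemma xi_comm_sumr n (f : 'I_n -> alg L) c : [[c, \sum_i f i]] = \sum_i [[c, f i]].
Proof.
by apply: (big_morph (fun a => [[c, a]])); [move=> x y; exact: xi_commDr|exact: xi_comm0r].
Qed.

Lemma xi_commMnl n a b : [[a *+ n, b]] = [[a, b]] *+ n.
Proof. by elim: n => [|n IH]; rewrite ?mulr0n ?xi_comm0l// !mulrS xi_commDl IH. Qed.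

Lemma xi_commMnr n a b : [[a, b *+ n]] = [[a, b]] *+ n.
Proof. by elim: n => [|n IH]; rewrite ?mulr0n ?xi_comm0r// !mulrS xi_commDr IH. Qed.

(** The number p of terms is kept apart from the order n: for p = n the last term is
    d n (D 0 a), and the sum with p = n - 1 determines d n from D. *)
Definition convolve D d p n (a : alg L) := \sum_(k < p) d k.+1 (D (n - k.+1)%N a).

(** In terms of the power series D(t) and d(t) with coefficients D n and d n, the
    last condition reads t D'(t) = d(t) D(t). *)
Definition log_derivative D d := [/\ forall a, D 0 a = a, forall a, d 0 a = 0 &
  forall n a, D n a *+ n = convolve D d n n a].

(** Apply t d/dt to the product of the series D(t) a and D(t) b. *)
Lemma log_derivative_leibniz D d n a b : log_derivative D d ->
  (\sum_(i < n.+1) [[D i a, D (n - i)%N b]]) *+ n =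
  \sum_(k < n) \sum_(i < (n - k.+1).+1)
    ([[d k.+1 (D i a), D (n - k.+1 - i)%N b]] + [[D i a, d k.+1 (D (n - k.+1 - i)%N b)]]).
Proof.
move=> [_ _ Dd].
(* n is split as i + (n - i); the second summand is brought to the form of the
   first by reversing the order of summation *)
have rev m (f : nat -> nat -> alg L) :
    \sum_(i < m.+1) f i (m - i)%N = \sum_(i < m.+1) f (m - i)%N i.
  rewrite (reindex_inj rev_ord_inj)/=; apply: eq_bigr => i _.
  by rewrite subSS subKn// -ltnS.
under [RHS]eq_bigr do rewrite big_split.
rewrite [RHS]big_split/=.
have /= <- := triangular_convolution (fun k i j => [[d k.+1 (D i a), D j b]]) n.
under [X in _ + X]eq_bigr => k _.
  rewrite (rev (n - k.+1)%N (fun i j => [[D i a, d k.+1 (D j b)]])); over.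
have /= <- := triangular_convolution (fun k i j => [[D j a, d k.+1 (D i b)]]) n.
under [X in _ = X + _]eq_bigr => i _.
  rewrite -(xi_comm_suml (fun k : 'I_i => d k.+1 (D (i - k.+1)%N a))).
  rewrite -/(convolve D d i i a) -Dd xi_commMnl; over.
under [X in _ = _ + X]eq_bigr => i _.
  rewrite -(xi_comm_sumr (fun k : 'I_i => d k.+1 (D (i - k.+1)%N b))).
  rewrite -/(convolve D d i i b) -Dd xi_commMnr; over.
rewrite -(rev n (fun i j => [[D i a, D j b]] *+ j)) -big_split -sumrMnl/=.
by apply: eq_bigr => i _; rewrite -mulrnDr subnKC// -ltnS.
Qed.

Lemma log_derivative_central_linear D d n : log_derivative D d ->
  (forall k w a, (k <= n)%N -> central w -> d k (w * a) = w * d k a) ->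
  forall m w a, (m <= n)%N -> central w -> D m (w * a) = w * D m a.
Proof.
move=> [D0 _ Dd] dw m w a mn cw; elim/ltn_ind: m a mn => -[_|m IH] a mn.
  by rewrite !D0.
apply: (@lmod_mulrnI F _ m); rewrite -mulrnAr !Dd /convolve mulr_sumr.
apply: eq_bigr => k _; rewrite subSS IH ?ltnS ?leq_subr//.
  by rewrite dw// (leq_trans (ltn_ord k)).
by rewrite (leq_trans (leq_subr _ _))// ltnW.
Qed.

(** Applying d k.+1 termwise produces an error d k.+1 1 * D m [[a, b]], and D m is
    linear over the centre, so the error is the image under D m of
    d k.+1 1 * [[a, b]] = 0. The products D i a * D (m - i) b need not vanish
    separately. *)
Lemma log_derivative_step D d k m a b :
  (forall x y, d k.+1 [[x, y]] = [[d k.+1 x, y]] + [[x, d k.+1 y]] - d k.+1 1 * [[x, y]]) ->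
  d k.+1 1 * [[a, b]] = 0 -> central (d k.+1 1) ->
  (forall w c, central w -> D m (w * c) = w * D m c) ->
  D m [[a, b]] = \sum_(i < m.+1) [[D i a, D (m - i)%N b]] ->
  d k.+1 (D m [[a, b]]) = \sum_(i < m.+1)
    ([[d k.+1 (D i a), D (m - i)%N b]] + [[D i a, d k.+1 (D (m - i)%N b)]]).
Proof.
move=> dxi dab cd Dw Dm; rewrite Dm linear_sum/=.
under eq_bigr do rewrite dxi.
by rewrite sumrB -mulr_sumr -Dm -Dw// dab linear0 subr0.
Qed.

Hypothesis structure : forall d : {linear alg L -> alg L},
  xi_Lie_at_zero_products xi d -> twisted_xi_Lie xi d.

(** Multiplied by n, the rule for D n is the Leibniz formula of order n, read term
    by term with [log_derivative_step]. *)
Lemma derivations_to_higher D d : log_derivative D d ->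
  (forall n, xi_Lie_at_zero_products xi (d n)) -> xi_Lie_higher_derivations xi D.
Proof.
move=> Dd dL; have [D0 _ DdE] := Dd; split=> // n a b ab.
elim/ltn_ind: n => -[_|n IH].
  by rewrite big_ord_recl big_ord0 addr0 subn0 !D0.
apply: (@lmod_mulrnI F _ n); rewrite (log_derivative_leibniz _ _ _ Dd) DdE.
apply: eq_bigr => k _.
have [dxi d0 dc _] := structure (dL k.+1).
apply: log_derivative_step => //; first exact: d0.
  move=> w c cw; apply: (log_derivative_central_linear Dd) (leqnn _) cw.
  by move=> j v e _ cv; have [_ _ _] := structure (dL j); apply.
by apply: IH; rewrite ltnS subSS leq_subr.
Qed.

(** In the Leibniz formula of order n + 1, the terms with d 1, ..., d n agree by
    induction; what remains is the rule for d n.+1. *)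
Lemma higher_to_derivations D d : log_derivative D d ->
  xi_Lie_higher_derivations xi D -> forall n, xi_Lie_at_zero_products xi (d n).
Proof.
move=> Dd [_ DL]; have [D0 d0 DdE] := Dd; elim/ltn_ind => -[_|n IH] a b ab.
  by rewrite !d0 xi_comm0l xi_comm0r addr0.
have E := log_derivative_leibniz n.+1 a b Dd; rewrite -DL// DdE /convolve in E.
rewrite [LHS]big_ord_recr [RHS]big_ord_recr/= subnn big_ord1 !D0 in E.
apply: addrI (etrans E _); congr (_ + _); apply/esym; apply: eq_bigr => k _.
have [dxi dz dc _] := structure (IH k.+1 (ltn_ord k)).
apply: log_derivative_step => //; [exact: dz| |exact: DL].
move=> w c cw; apply: (log_derivative_central_linear (n := n) Dd) cw; last first.
  by rewrite subSS leq_subr.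
by move=> j v e jn cv; have [_ _ _] := structure (IH j jn); apply.
Qed.

Lemma convolve_linear D d p n : linear (convolve D d p n).
Proof.
move=> t u v; rewrite /convolve scaler_sumr -big_split; apply: eq_bigr => k _ /=.
by rewrite !linearP.
Qed.

Definition linear_convolve D d p n : {linear alg L -> alg L} :=
  HB.pack (convolve D d p n)
    (GRing.isLinear.Build _ _ _ _ (convolve D d p n) (@convolve_linear D d p n)).

Lemma log_derivative_integrate d : (forall a, d 0 a = 0) -> exists D, log_derivative D d.
Proof.
move=> d0; pose step n D : {linear alg L -> alg L} :=
  if n is 0 then idfun else (n%:R^-1 : F) \*: linear_convolve D d n n.
have [|D DE] := @course_of_values _ step _ (idfun : {linear alg L -> alg L}).
  move=> [|n] D D' DD' //; apply: linear_ext => a /=; congr (_ *: _).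
  by apply: eq_bigr => k _; rewrite DD'// subSS ltnS leq_subr.
exists D; split=> // [a|[|n] a]; first by rewrite DE.
  by rewrite mulr0n /convolve big_ord0.
by rewrite [in LHS]DE/= -scaler_nat scalerA mulfV ?pnatr_eq0// scale1r.
Qed.

Lemma log_derivative_exists D : (forall a, D 0 a = a) -> exists d, log_derivative D d.
Proof.
move=> D0; pose step n d : {linear alg L -> alg L} :=
  if n is m.+1 then (n%:R : F) \*: D n \- linear_convolve D d m n else \0.
have [|d dE] := @course_of_values _ step _ (idfun : {linear alg L -> alg L}).
  move=> [|n] d d' dd' //; apply: linear_ext => a /=; congr (_ - _).
  by apply: eq_bigr => k _; rewrite dd' ?ltnS.
exists d; split=> // [a|[|n] a]; first by rewrite dE.
  by rewrite mulr0n /convolve big_ord0.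
by rewrite /convolve big_ord_recr/= subnn D0 (dE n.+1)/= addrCA subrr addr0 scaler_nat.
Qed.

Lemma log_derivative_inj D D' d : log_derivative D d -> log_derivative D' d -> D = D'.
Proof.
move=> [D0 _ Dd] [D0' _ Dd']; apply/funext; elim/ltn_ind => -[_|n IH].
  by apply: linear_ext => a; rewrite D0 D0'.
apply: linear_ext => a; apply: (@lmod_mulrnI F _ n); rewrite Dd Dd'.
by apply: eq_bigr => k _; rewrite IH// subSS ltnS leq_subr.
Qed.

Lemma log_derivative_unique D d d' : log_derivative D d -> log_derivative D d' -> d = d'.
Proof.
move=> [D0 d0 Dd] [_ d0' Dd']; apply/funext; elim/ltn_ind => -[_|n IH].
  by apply: linear_ext => a; rewrite d0 d0'.
apply: linear_ext => a; have := Dd n.+1 a; rewrite Dd' /convolve !big_ord_recr/=.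
rewrite subnn D0 => E; apply/esym; apply: addrI (etrans E _); congr (_ + _).
by apply: eq_bigr => k _; rewrite IH// ltnS.
Qed.

Lemma log_derivative_bij : exists Phi,
  set_bij (xi_Lie_higher_derivations (L := L) xi)
          (xi_Lie_derivation_sequences (L := L) xi) Phi.
Proof.
have /choice[Phi PhiE] : forall D, exists d,
    (forall a, D 0 a = a) -> log_derivative D d.
  move=> D; have [D0|D0] := pselect (forall a, D 0 a = a); last by exists D.
  by have [d Dd] := log_derivative_exists D0; exists d.
exists Phi; split.
- move=> D DG; have Dd := PhiE D DG.1; split; first by case: Dd.
  by move=> n; exact: (higher_to_derivations Dd DG).
- move=> D D' /set_mem DG /set_mem DG' e.
  by apply: (log_derivative_inj (PhiE D DG.1)); rewrite e; exact: (PhiE D' DG'.1).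
- move=> d [d0 dL]; have [D Dd] := log_derivative_integrate d0.
  have DG := derivations_to_higher Dd dL; exists D => //.
  exact: (log_derivative_unique (PhiE D DG.1) Dd).
Qed.

End Correspondence.

Theorem theorem3p4 (R : realType) (F : numFieldType)
    (hF : real_or_complex R F) (X : completeNormedModType F)
    (L : subspace_lattice X) (hL : is_Jlattice L) (xi : F) (hxi : xi <> 1) :
  exists Phi : (nat -> {linear alg L -> alg L}) -> (nat -> {linear alg L -> alg L}),
    set_bij (xi_Lie_higher_derivations (L := L) xi)
            (xi_Lie_derivation_sequences (L := L) xi) Phi.
Proof.
apply: log_derivative_bij => d.
exact: (xi_Lie_structure hL (separating_functionals hF) hxi).
Qed.
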